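(* Let $l, m, n, k$ be positive integers with $l \leq m < n$. Let $\varepsilon([l,m],n)$ denote the number of nonempty subsets $X \subseteq [1,n]$ with $X \cap [l,m] = \emptyset$ and $\gcd(X\cup\{n\}) = 1$, and $\varepsilon_k([l,m],n)$ the number of subsets $X \subseteq [1,n]$ with $\#X = k$, $X\cap[l,m] = \emptyset$ and $\gcd(X\cup\{n\})=1$. Then (a) $\displaystyle \varepsilon([l,m],n) = \sum_{d\mid n}\mu(d)\, 2^{\lfloor (l-1)/d\rfloor + n/d - \lfloor m/d\rfloor}$; (b) $\displaystyle \varepsilon_k([l,m],n) = \sum_{d\mid n}\mu(d) \binom{\lfloor (l-1)/d\rfloor + n/d - \lfloor m/d\rfloor}{k}$.
   Context: For integers $a \leq b$, $[a,b] = \{a,\ldots,b\}$. $\mu$ is the Möbius function, $\lfloor x\rfloor$ the floor function; sums run over positive divisors $d$ of $n$. *)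

(* Defs.v *)
From mathcomp Require Import all_boot all_order all_algebra.

Set Implicit Arguments.
Unset Strict Implicit.
Unset Printing Implicit Defensive.

Import GRing.Theory.

(* Subsets of [1, n] are represented inside 'I_n.+1 = {0, ..., n}, so that
   the value of an ordinal is the integer it stands for and ord_max is n. *)
Definition nat_itv (n a b : nat) : {set 'I_n.+1} :=
  [set i : 'I_n.+1 | a <= i <= b].

Definition gcd_set (n : nat) (X : {set 'I_n.+1}) : nat :=
  \big[gcdn/0]_(i in X) (i : nat).

Definition eps (l m n : nat) : nat :=
  #|[set X : {set 'I_n.+1} |
      [&& X != set0,
          X \subset nat_itv n 1 n,
          X :&: nat_itv n l m == set0
        & gcd_set (X :|: [set ord_max]) == 1]]|.

Definition eps_k (k l m n : nat) : nat :=
  #|[set X : {set 'I_n.+1} |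
      [&& #|X| == k,
          X \subset nat_itv n 1 n,
          X :&: nat_itv n l m == set0
        & gcd_set (X :|: [set ord_max]) == 1]]|.

(* Only meaningful for d > 0 (the value at 0 is junk). *)
Definition moebius (d : nat) : int :=
  if all (fun p => logn p d == 1) (primes d)
  then ((-1) ^+ size (primes d))%R else 0%R.

(* Main.v *)
(** Moebius inversion: [gcd (X \cup {n}) = 1] is detected by the sum of
    [moebius d] over the divisors [d] of that gcd, all of which divide [n].
    After exchanging the sums, [d] contributes the number of admissible [X]
    all of whose elements are multiples of [d]; these are arbitrary subsets
    (or [k]-subsets) of the multiples of [d] in [[1, l-1]] and [[m+1, n]].
    Nonemptiness in (a) is automatic: [X = set0] has gcd [n], and [1 < n]. *)
Require Import Defs.
From mathcomp Require Import all_boot all_order all_algebra.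
From mathcomp Require Import zify.

Set Implicit Arguments.
Unset Strict Implicit.
Unset Printing Implicit Defensive.

Import GRing.Theory.

(** If [p] divides [e], its exponent in [p * e] is at least 2. Otherwise [p * e] has exactly one
    more prime factor than [e], with the other exponents unchanged, so only the sign flips. *)
Lemma moebius_pmul (p e : nat) : prime p -> 0 < e ->
  moebius (p * e) = (if (p %| e)%N then 0 else - moebius e)%R.
Proof.
move=> pp e0; have p0 := prime_gt0 pp.
have pe0 : 0 < p * e by rewrite muln_gt0 p0.
have lognE q : logn q (p * e) = (q == p) + logn q e.
  by rewrite lognM // logn_prime.
case: ifPn => pe; rewrite /moebius.
  case: ifP => // /allP/(_ p); rewrite mem_primes pp pe0 dvdn_mulr // => /(_ isT).
  by rewrite lognE eqxx add1n eqSS -[_ == _]negbK -lt0n logn_gt0 mem_primes pp e0 pe.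
have pNe : p \notin primes e by rewrite mem_primes (negPf pe) !andbF.
have perm : perm_eq (primes (p * e)) (p :: primes e).
  apply: uniq_perm; rewrite /= ?primes_uniq ?pNe //.
  by move=> q; rewrite primesM // primes_prime // !inE.
rewrite (perm_all _ perm) (perm_size perm) /= lognE eqxx.
have -> : logn p e = 0 by apply/eqP; rewrite -leqn0 leqNgt logn_gt0.
rewrite (@eq_in_all _ _ (fun q => logn q e == 1)) => [|q qe].
  by rewrite addn0 /=; case: ifP; rewrite ?oppr0 // exprS mulN1r.
by rewrite lognE; case: (q =P p) qe pNe => // -> ->.
Qed.

(* For a prime [p] dividing [n], the terms at [d] and [p * d] cancel when
   [p] does not divide [d], and the remaining terms vanish. *)
Lemma sum_moebius (n : nat) : 0 < n ->
  (\sum_(d <- divisors n) moebius d = (n == 1%N)%:Z)%R.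
Proof.
move=> n0; have [->|n1] := eqVneq n 1; first by rewrite big_seq1.
have pp : prime (pdiv n) by apply: pdiv_prime; lia.
move: (pdiv n) pp (pdiv_dvd n) => p pp /dvdnP[q nE].
have p0 := prime_gt0 pp; have q0 : 0 < q by rewrite nE in n0; lia.
rewrite (bigID (dvdn p)) /= -big_filter.
have perm1 : perm_eq [seq d <- divisors n | p %| d] [seq p * e | e <- divisors q].
  apply: uniq_perm; rewrite ?filter_uniq ?map_inj_uniq ?divisors_uniq //.
    by move=> x y /eqP; rewrite eqn_pmul2l // => /eqP.
  move=> d; rewrite mem_filter -dvdn_divisors // nE.
  apply/andP/mapP => [[/dvdnP[e ->]] | [e]].
    by rewrite dvdn_pmul2r // => eq; exists e; rewrite -?dvdn_divisors // mulnC.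
  by rewrite -dvdn_divisors // => eq ->; rewrite dvdn_mulr // mulnC dvdn_pmul2r.
(* A divisor [d] of [n = q * p] that [p] does not divide is coprime to [p], hence divides [q]. *)
have perm2 : perm_eq [seq d <- divisors n | ~~ (p %| d)]
                     [seq d <- divisors q | ~~ (p %| d)].
  apply: uniq_perm; rewrite ?filter_uniq ?divisors_uniq // => d.
  rewrite !mem_filter -!dvdn_divisors // nE; case: (boolP (p %| d)) => //= pd.
  by rewrite Gauss_dvdl // coprime_sym prime_coprime.
rewrite (perm_big _ perm1) big_map -[X in (_ + X)%R]big_filter (perm_big _ perm2).
(* Both halves are now indexed by the divisors [e] of [q], so they can be added term by term. *)
rewrite big_filter [X in (_ + X)%R]big_mkcond -big_split /= big_seq big1 // => e.
rewrite -dvdn_divisors // => /(dvdn_gt0 q0) e0; rewrite moebius_pmul //.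
by case: ifP; rewrite /= ?addr0 ?addNr.
Qed.

Definition avoiding_multiples (l m n d : nat) : {set 'I_n.+1} :=
  [set i in nat_itv n 1 n :\: nat_itv n l m | d %| i].

Lemma card_multiples (n b d : nat) : 0 < d -> b <= n ->
  #|[set i in nat_itv n 1 b | d %| i]| = b %/ d.
Proof.
move=> d0; elim: b => [|b IH] bn.
  by rewrite div0n; apply/eqP; rewrite cards_eq0; apply/eqP/setP=> i; rewrite !inE; lia.
rewrite divnS // -IH; last lia.
have bE : val (inord b.+1 : 'I_n.+1) = b.+1 by rewrite /= inordK.
case: (boolP (d %| b.+1)) => db.
  rewrite (cardsD1 (inord b.+1)) !inE bE db leqnn /=; congr (_ + _).
  apply: eq_card => i; rewrite !inE -val_eqE bE /=; lia.
rewrite add0n; apply: eq_card => i; rewrite !inE.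
have [->|ib] := eqVneq (i : nat) b.+1; first by rewrite (negPf db) !andbF.
by congr (_ && _); lia.
Qed.

Lemma card_avoiding_multiples (l m n d : nat) :
    0 < d -> 0 < l -> l <= m -> m <= n ->
  #|avoiding_multiples l m n d| = (l - 1) %/ d + n %/ d - m %/ d.
Proof.
move=> d0 l0 lm mn.
pose S b := [set i in nat_itv n 1 b | d %| i].
have -> : avoiding_multiples l m n d = S (l - 1) :|: (S n :\: S m).
  by apply/setP=> i; rewrite !inE; case: (d %| i); lia.
have SI : S (l - 1) :&: (S n :\: S m) = set0.
  by apply/setP=> i; rewrite !inE; case: (d %| i); lia.
have SS : S m \subset S n.
  by apply/subsetP=> i; rewrite !inE; case: (d %| i); lia.
rewrite cardsU SI cards0 subn0 cardsD (setIidPr SS) !card_multiples //; last lia.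
(* Truncated subtraction regroups safely because [m <= n] gives [m %/ d <= n %/ d]. *)
by rewrite addnBA // leq_div2r.
Qed.

Lemma dvdn_gcd_set (n d : nat) (X : {set 'I_n.+1}) :
  (d %| gcd_set (X :|: [set ord_max])) = (d %| n) && (X \subset [set i : 'I_n.+1 | d %| i]).
Proof.
apply/dvdn_biggcdP/andP => [H | [dn /subsetP XS] i].
  split; first by apply: (H ord_max); rewrite !inE eqxx orbT.
  by apply/subsetP=> i iX; rewrite inE; apply: H; rewrite inE iX.
by rewrite !inE => /orP[/XS|/eqP->] //; rewrite inE.
Qed.

(** The predicate [P] lets one inversion serve both parts: it is trivial for (a) and fixes the
    cardinality for (b). *)
Lemma card_coprime_avoiding (l m n : nat) (P : pred {set 'I_n.+1}) :
    0 < n ->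
  (#|[set X : {set 'I_n.+1} |
      [&& P X,
          X \subset nat_itv n 1 n,
          X :&: nat_itv n l m == set0
        & gcd_set (X :|: [set ord_max]) == 1%N]]|%:Z =
   \sum_(d <- divisors n) moebius d *
     #|[set X : {set 'I_n.+1} | (X \subset avoiding_multiples l m n d) & P X]|%:Z)%R.
Proof.
move=> n0.
pose A := nat_itv n 1 n :\: nat_itv n l m.
pose g X := gcd_set (X :|: [set (ord_max : 'I_n.+1)]).
have cardE (Q : pred {set 'I_n.+1}) :
    (#|[set X | Q X]|%:Z = \sum_(X | Q X) 1)%R.
  by rewrite -sum1dep_card -[LHS]natz natr_sum.
have gn X : g X %| n.
  by have := dvdnn (g X); rewrite {2}/g dvdn_gcd_set => /andP[].
(* The indicator of [g X = 1] becomes a Möbius sum over the divisors of [g X]. As [g X] divides [n],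
   these are the divisors of [n] that divide [g X], a range whose ambient list no longer depends on
   [X]. *)
transitivity (\sum_(X | P X && (X \subset A))
                \sum_(d <- divisors n | (d %| g X)%N) moebius d)%R.
  rewrite cardE (eq_bigl (fun X => (P X && (X \subset A)) && (g X == 1))).
    rewrite big_mkcondr; apply: eq_bigr => X _.
    have g0 : 0 < g X by apply: dvdn_gt0 (gn X).
    rewrite -big_filter (perm_big (divisors (g X))) ?sum_moebius //=.
      by case: (_ == _).
    apply: uniq_perm; rewrite ?filter_uniq ?divisors_uniq // => d.
    rewrite mem_filter -!dvdn_divisors //.
    by apply: andb_idr => dg; apply: dvdn_trans (gn X).
  by move=> X; rewrite subsetD setI_eq0 !andbA.
rewrite (exchange_big_dep predT) //=; apply: eq_big_seq => d.
rewrite -dvdn_divisors // => dn; rewrite cardE big_distrr /= mulr1.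
have -> : avoiding_multiples l m n d = A :&: [set i : 'I_n.+1 | d %| i].
  by apply/setP=> i; rewrite !inE.
(* Since [d] divides [n], the element [ord_max] imposes nothing: [d] divides [g X] exactly when it
   divides every element of [X]. *)
by apply: eq_bigl => X; rewrite dvdn_gcd_set dn /= -andbA andbC subsetI.
Qed.

Theorem theorem3 (l m n k : nat)
    (hl : 0 < l) (hm : 0 < m) (hn : 0 < n) (hk : 0 < k)
    (hlm : l <= m) (hmn : m < n) :
  ((eps l m n)%:Z =
     \sum_(d <- divisors n)
        moebius d * 2 ^+ ((l - 1) %/ d + n %/ d - m %/ d)%N)%R
  /\
  ((eps_k k l m n)%:Z =
     \sum_(d <- divisors n)
        moebius d * ('C((l - 1) %/ d + n %/ d - m %/ d, k))%:Z)%R.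
Proof.
have cardA d : d \in divisors n ->
    #|avoiding_multiples l m n d| = (l - 1) %/ d + n %/ d - m %/ d.
  rewrite -dvdn_divisors // => /(dvdn_gt0 hn) d0.
  by rewrite card_avoiding_multiples // ltnW.
split.
  have -> : eps l m n = #|[set X : {set 'I_n.+1} |
      [&& predT X, X \subset nat_itv n 1 n, X :&: nat_itv n l m == set0
        & gcd_set (X :|: [set ord_max]) == 1]]|.
    (* The empty set fails the gcd condition, as [1 <= l <= m < n] forces [n] to differ from 1. *)
    apply: eq_card => X; rewrite !inE; case: eqP => //= ->.
    by rewrite set0U /gcd_set big_set1 /=; lia.
  rewrite (card_coprime_avoiding l m predT) //; apply: eq_big_seq => d /cardA <-.
  congr (_ * _)%R; rewrite (_ : [set X | _] = powerset (avoiding_multiples l m n d)).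
    by rewrite card_powerset -natz natrX.
  by apply/setP=> X; rewrite !inE andbT.
rewrite /eps_k (card_coprime_avoiding l m (fun X => #|X| == k)) //.
by apply: eq_big_seq => d /cardA <-; rewrite cards_draws.
Qed.
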